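(* Let $\sigma\in S_m$ be chosen uniformly at random. Then, for any integer $2\leq k\leq m/2$, $$\rho_{\sigma}\leq 1-\frac{1}{m!}+O\left(\frac{4^{m}}{(m-k)!\,m!}\right)$$ holds with probability at least $1-\frac{2}{(k+1)!}-m2^{-m/2}$. Here the implied constant in the $O$-term is absolute (independent of $m$, $k$ and $\sigma$).
   Context: $S_n$ denotes the set of permutations of $\{1,\dots,n\}$. For distinct integers $x_1,\dots,x_k$, $\mathrm{st}(x_1,\dots,x_k)\in S_k$ is the permutation obtained by replacing each entry by its rank among $x_1,\dots,x_k$. A permutation $\pi\in S_n$ contains $\sigma\in S_m$ as a consecutive pattern if $\mathrm{st}(\pi_{i+1},\dots,\pi_{i+m})=\sigma$ for some $0\le i\le n-m$; otherwise it is $\sigma$-avoiding. $\alpha_n(\sigma)$ is the number of $\sigma$-avoiding permutations in $S_n$, and $\rho_\sigma=\lim_{n\to\infty}(\alpha_n(\sigma)/n!)^{1/n}$ (this limit is known to exist). *)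

(* Defs.v *)
From mathcomp Require Import all_boot all_order all_algebra all_fingroup.
From mathcomp Require Import all_classical all_reals all_analysis.

Set Implicit Arguments.
Unset Strict Implicit.
Unset Printing Implicit Defensive.

Import Order.TTheory GRing.Theory Num.Theory.
Import numFieldNormedType.Exports.

Local Open Scope ring_scope.

(* Positions and values are numbered from 0, so that 'S_n stands for the
   permutations of {1, ..., n} shifted by one; the rank of an entry is the
   number of strictly smaller entries. *)
Definition one_line (n : nat) (p : 'S_n) : seq nat :=
  [seq nat_of_ord (p i) | i <- enum 'I_n].

Definition st (s : seq nat) : seq nat :=
  [seq count (fun y => (y < x)%N) s | x <- s].

Definition contains_consecutive (n m : nat) (p : 'S_n) (s : 'S_m) : bool :=
  [exists i : 'I_n.+1,
    (i + m <= n)%N && (st (take m (drop i (one_line p))) == one_line s)].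

Definition alpha (n m : nat) (s : 'S_m) : nat :=
  #|[pred p : 'S_n | ~~ contains_consecutive p s]|.

(* The sequence always converges, so the default value of limn plays no role. *)
Definition rho (R : realType) (m : nat) (s : 'S_m) : R :=
  limn (fun n : nat => ((alpha n s)%:R / n`!%:R) `^ (n%:R^-1)).

Definition finite_unif_prob (R : realType) (T : finType) (A : pred T) : R :=
  #|A|%:R / #|T|%:R.

(* Main.v *)
Require Import Defs.
From mathcomp Require Import all_boot all_order all_algebra all_fingroup.
From mathcomp Require Import all_classical all_reals all_analysis.
From mathcomp Require Import zify ring lra.

Set Implicit Arguments.
Unset Strict Implicit.
Unset Printing Implicit Defensive.

Import numFieldNormedType.Exports.
Import Order.TTheory GRing.Theory Num.Theory.

(* The pattern of a uniform permutation on a window of length b is uniform on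
   S_b and independent of what happens on the other positions.

   Let p(N) be the probability that a uniform permutation has no occurrence of
   s among its first N entries. The loss p(N-1) - p(N) is the probability of a
   first occurrence ending at N. It is at most p(N-m)/m!, which already forces
   p(N-2m) <= 2 p(N). It is at least p(N-m)/m! minus the probability that two
   occurrences at some distance d < m end at N. If s has no self-overlap longer
   than k, then d >= m-k, and three disjoint windows bound the latter by
   p(N-m-d)/(m! d!). Altogether
   p(N) <= (1 - 1/m! + 2m/(m! (m-k)!)) p(N-1).

   A self-overlap of s of length l <= m/2 compares two disjoint blocks, hence
   has probability 1/l!, and these sum to at most 2/(k+1)! over l > k. A longer
   one is a period d < m/2 of the order relations; some multiple e of d lies in
   (m/4, m/2], and two disjoint blocks of length e being isomorphic has
   probability 1/e!, which is less than 2^(-m/2) once m >= 36. For smaller m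
   the constant C makes the right-hand side at least 1. *)

Local Open Scope nat_scope.

(** * Union bound, ranks, and permutations as functions on [nat] *)

Lemma card_union_bound (T I : finType) (P Q : pred T) (R : I -> pred T) :
  (forall x, P x -> Q x \/ exists i, R i x) ->
  #|P| <= #|Q| + \sum_i #|R i|.
Proof.
move=> PQR.
have cardE (A : pred T) : #|A| = \sum_x nat_of_bool (A x).
  by rewrite -sum1_card big_mkcond.
rewrite !cardE (eq_bigr _ (fun i _ => cardE (R i))) exchange_big -big_split /=.
apply: leq_sum => x _; case Px: (P x) => //.
have [Qx | [i Rix]] := PQR x Px; first by rewrite Qx.
by rewrite (bigD1 i) //= Rix; lia.
Qed.

Definition rk (f : nat -> nat) m u := count (fun v => f v < f u) (iota 0 m).

Lemma rk_ltn f m u v : u < m -> (rk f m u < rk f m v) = (f u < f v).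
Proof.
move=> um; have [fuv|fvu] := ltnP (f u) (f v); last first.
  apply/negbTE; rewrite -leqNgt; apply: sub_count => w /= fwv.
  exact: leq_trans fvu.
have u1 : count (pred1 u) (iota 0 m) = 1.
  by rewrite count_uniq_mem ?iota_uniq // mem_iota um.
have u0 : count (predI (fun w => f w < f u) (pred1 u)) (iota 0 m) = 0.
  rewrite (@eq_count _ _ pred0) ?count_pred0 // => w /=.
  by apply/negP => /andP[/[swap]/eqP->]; rewrite ltnn.
rewrite /rk -addn1 -{1}u1 -count_predUI u0 addn0.
by apply: sub_count => w /= /orP[/ltn_trans->|/eqP->].
Qed.

Lemma rk_ub f m u : u < m -> rk f m u < m.
Proof.
move=> um; rewrite /rk -{2}(size_iota 0 m) ltn_neqAle count_size andbT.
rewrite -all_count; apply/negP => /allP /(_ u).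
by rewrite mem_iota um ltnn => /(_ isT).
Qed.

(* Extending by the identity outside 'I_n makes patterns of windows available
   without ordinal casts. *)
Definition pn n (p : 'S_n) (x : nat) : nat :=
  if insub x is Some y then nat_of_ord (p y) else x.

Lemma pnE n (p : 'S_n) (i : 'I_n) : pn p i = p i.
Proof. by rewrite /pn valK. Qed.

Lemma pn_out n (p : 'S_n) x : n <= x -> pn p x = x.
Proof. by move=> nx; rewrite /pn insubN // -leqNgt. Qed.

Lemma pn_ltn n (p : 'S_n) x : (pn p x < n) = (x < n).
Proof.
have [xn|xn] := ltnP x n; last by rewrite pn_out // ltnNge xn.
by rewrite (pnE p (Ordinal xn)) ltn_ord.
Qed.

Lemma pn_inj n (p : 'S_n) : injective (pn p).
Proof.
move=> x y; have [xn|xn] := ltnP x n; have [yn|yn] := ltnP y n.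
- rewrite (pnE p (Ordinal xn)) (pnE p (Ordinal yn)) => /val_inj /perm_inj.
  by case.
- by move=> e; have := pn_ltn p x; rewrite e pn_ltn xn ltnNge yn.
- by move=> e; have := pn_ltn p y; rewrite -e pn_ltn yn ltnNge xn.
- by rewrite !pn_out.
Qed.

Lemma pnM n (p q : 'S_n) x : pn (p * q)%g x = pn q (pn p x).
Proof.
have [xn|xn] := ltnP x n; last by rewrite !pn_out.
by rewrite (pnE _ (Ordinal xn)) permM (pnE p (Ordinal xn)) pnE.
Qed.

Lemma pn_ext n (p q : 'S_n) : (forall x, x < n -> pn p x = pn q x) -> p = q.
Proof. by move=> e; apply/permP=> i; apply/val_inj; rewrite /= -!pnE e. Qed.

Lemma pn_exists n (f : nat -> nat) :
  (forall x, x < n -> f x < n) ->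
  (forall x y, x < n -> y < n -> f x = f y -> x = y) ->
  exists p : 'S_n, forall x, x < n -> pn p x = f x.
Proof.
move=> fn fI; pose g (i : 'I_n) := Ordinal (fn i (ltn_ord i)).
have gI : injective g by move=> i j [/fI] /(_ (ltn_ord i) (ltn_ord j)) /val_inj.
by exists (perm gI) => x xn; rewrite (pnE _ (Ordinal xn)) permE.
Qed.

(** Since [pn s] permutes [iota 0 m], the rank counts the values below [pn s u], and there are
    [pn s u] of them. *)
Lemma rk_pn m (s : 'S_m) u : u < m -> rk (pn s) m u = pn s u.
Proof.
move=> um; have um' : pn s u <= m by rewrite ltnW ?pn_ltn.
rewrite /rk -(count_map (pn s) (fun y => y < pn s u)).
have sub : {subset [seq pn s i | i <- iota 0 m] <= iota 0 m}.
  by move=> _ /mapP[x + ->]; rewrite !mem_iota /= !add0n pn_ltn.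
have uq : uniq [seq pn s i | i <- iota 0 m].
  by rewrite map_inj_uniq ?iota_uniq //; apply: pn_inj.
have [_ eqi] := uniq_min_size uq sub ltac:(by rewrite size_map).
rewrite (seq.permP (uniq_perm uq (iota_uniq 0 m) eqi)).
move: (pn s u) um' => c cm; rewrite -(subnKC cm) iotaD count_cat add0n.
have -> : count (fun y => y < c) (iota 0 c) = c.
  rewrite -[RHS](size_iota 0 c); apply/eqP; rewrite -all_count.
  by apply/allP => y; rewrite mem_iota.
rewrite (@eq_in_count _ _ pred0) ?count_pred0 ?addn0 // => y.
by rewrite mem_iota => /andP[cy _] /=; rewrite ltnNge cy.
Qed.

(** * Occurrences of a pattern and uniformity of window patterns *)

Definition occurs n m (p : 'S_n) (s : 'S_m) i : bool :=
  [forall u : 'I_m, forall v : 'I_m,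
    (pn p (i + u) < pn p (i + v)) == (pn s u < pn s v)].

Lemma occursP n m (p : 'S_n) (s : 'S_m) i :
  reflect (forall u v, u < m -> v < m ->
             (pn p (i + u) < pn p (i + v)) = (pn s u < pn s v)) (occurs p s i).
Proof.
apply: (iffP idP) => [h u v um vm|h].
  by have /forallP/(_ (Ordinal um))/forallP/(_ (Ordinal vm))/eqP := h.
by apply/forallP => u; apply/forallP => v; apply/eqP/h.
Qed.

Lemma occurs_rk n m (p : 'S_n) (s : 'S_m) i :
  occurs p s i <-> forall u, u < m -> rk (fun x => pn p (i + x)) m u = pn s u.
Proof.
split=> [/occursP h u um|h].
  rewrite -rk_pn //; apply: eq_in_count => v.
  by rewrite mem_iota => vm; rewrite h.
by apply/occursP => u v um vm; rewrite -!h // rk_ltn.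
Qed.

Lemma one_lineE n (p : 'S_n) : one_line p = [seq pn p x | x <- iota 0 n].
Proof.
rewrite -val_enum_ord -map_comp /one_line.
by apply: eq_map => i /=; rewrite pnE.
Qed.

Lemma contains_consecutiveE n m (p : 'S_n) (s : 'S_m) :
  contains_consecutive p s =
  [exists i : 'I_n.+1, (i + m <= n) && occurs p s i].
Proof.
apply: eq_existsb => i; case: (leqP (i + m) n) => //= imn.
have -> : take m (drop i (one_line p)) = [seq pn p (i + x) | x <- iota 0 m].
  rewrite one_lineE -map_drop -map_take drop_iota take_iota.
  rewrite (_ : minn m _ = m); last by lia.
  by rewrite -{1}[0 + i]addnC iotaDl -map_comp.
rewrite /st -map_comp one_lineE; apply/eqP/idP.
  move/eq_in_map => h; apply/occurs_rk => u um; rewrite -h ?mem_iota //=.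
  by rewrite count_map.
move/occurs_rk => h; apply/eq_in_map => u; rewrite mem_iota => um /=.
by rewrite count_map -h.
Qed.

Lemma occurs_exists n m (p : 'S_n) i : exists s : 'S_m, occurs p s i.
Proof.
have [||s sE] := @pn_exists m (rk (fun x => pn p (i + x)) m).
- by move=> x; apply: rk_ub.
- move=> x y xm ym e; apply/(@addnI i)/(@pn_inj n p).
  have lt a b ab := @rk_ltn (fun x => pn p (i + x)) m a b ab.
  by move: (lt x y xm) (lt y x ym); rewrite e ltnn /=; lia.
by exists s; apply/occurs_rk => u um; rewrite sE.
Qed.

Lemma occurs_uniq n m (p : 'S_n) (s t : 'S_m) i :
  occurs p s i -> occurs p t i -> s = t.
Proof.
move=> /occurs_rk hs /occurs_rk ht; apply: pn_ext => x xm.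
by rewrite -hs ?ht.
Qed.

Lemma occurs_fix n m (q p : 'S_n) (s : 'S_m) j :
  (forall x, j <= x < j + m -> pn q x = x) ->
  occurs (q * p)%g s j = occurs p s j.
Proof.
move=> h; apply: eq_forallb => u; apply: eq_forallb => v.
by rewrite !pnM !h // leq_addr ltn_add2l ltn_ord.
Qed.

(** Every window has exactly one pattern, so the patterns partition [A]. *)
Lemma card_sum_occurs n b i (A : pred 'S_n) :
  #|A| = \sum_(t : 'S_b) #|[pred p | A p && occurs p t i]|.
Proof.
rewrite -sum1_card.
rewrite (eq_bigr (fun p => \sum_(t : 'S_b) nat_of_bool (occurs p t i))).
  rewrite exchange_big; apply: eq_bigr => t _ /=.
  by rewrite -big_mkcondr sum1_card.
move=> p _; have [t ot] := @occurs_exists n b p i.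
rewrite (bigD1 t) //= ot big1 // => t2 t2t; apply/eqP; rewrite eqb0.
by apply: contraNN t2t => ot2; rewrite (occurs_uniq ot2 ot).
Qed.

(* Permuting the positions of a window acts transitively on its possible
   patterns, so its pattern is uniform and independent of the rest. *)
Lemma card_occurs n b i (A : pred 'S_n) (t : 'S_b) : i + b <= n ->
  (forall q p, (forall x, ~~ (i <= x < i + b) -> pn q x = x) ->
     A p -> A (q * p)%g) ->
  #|[pred p | A p && occurs p t i]| * b`! = #|A|.
Proof.
move=> ibn inv.
have le (t1 t2 : 'S_b) :
    #|[pred p | A p && occurs p t1 i]| <= #|[pred p | A p && occurs p t2 i]|.
  (* Rearranging the window's positions by [r] turns pattern [t1] into [t2]; this injects one class
     into the other, and symmetry gives equality. *)
  pose r := (t2 * t1^-1)%g.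
  pose f x := if i <= x then i + pn r (x - i) else x.
  have fb x : ~~ (i <= x < i + b) -> f x = x.
    by rewrite /f => h; case: (leqP i x) => // ix; rewrite pn_out; lia.
  have fn x : x < n -> f x < n.
    have [h|/fb->//] := boolP (i <= x < i + b) => _.
    have := pn_ltn r (x - i); rewrite /f; case: ifP; lia.
  have fI x y : x < n -> y < n -> f x = f y -> x = y.
    rewrite /f => _ _; case: (leqP i x) => ix; case: (leqP i y) => iy; try lia.
    by move=> /addnI/pn_inj; lia.
  have [q0 qf] := pn_exists fn fI.
  rewrite -(card_imset _ (mulgI q0)); apply: subset_leq_card.
  apply/fintype.subsetP => _ /imsetP[p /andP[Ap /occursP pt1] ->].
  apply/andP; split.
    apply: inv => // x xb; have [xn|xn] := ltnP x n; last exact: pn_out.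
    by rewrite qf ?fb.
  apply/occursP => u v ub vb; rewrite !pnM !qf; try lia.
  rewrite /f !leq_addr ![i + _]addnC !addnK ![_ + i]addnC pt1 ?pn_ltn //.
  by rewrite -!pnM /r -mulgA mulVg mulg1.
rewrite (card_sum_occurs b i A).
rewrite (eq_bigr (fun=> #|[pred p | A p && occurs p t i]|)).
  by rewrite sum_nat_const card_Sn mulnC.
by move=> t' _; apply/eqP; rewrite eqn_leq !le.
Qed.

(** Only windows inside the first [N] entries count, while [n] stays fixed, so that all events live
    in one ['S_n]. For [N < m] the truncated subtraction leaves no window. *)
Definition avoid n m (p : 'S_n) (s : 'S_m) N :=
  all (fun i => ~~ occurs p s i) (iota 0 (N.+1 - m)).

Lemma avoidP n m (p : 'S_n) (s : 'S_m) N :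
  reflect (forall i, i + m <= N -> ~~ occurs p s i) (avoid p s N).
Proof.
apply: (iffP allP) => h i; last by rewrite mem_iota => ?; apply: h; lia.
by move=> ?; apply: h; rewrite mem_iota; lia.
Qed.

Lemma alphaE n m (s : 'S_m) : alpha n s = #|[pred p : 'S_n | avoid p s n]|.
Proof.
apply: eq_card => p; rewrite !inE contains_consecutiveE negb_exists.
apply/forallP/avoidP => h i.
  move=> imn; have := h (inord i); rewrite inordK ?imn //; lia.
by rewrite negb_and; case: leqP => //= /h.
Qed.

(** * Self-overlaps of a random pattern *)

(** For [j = m - l] this is a self-overlap of length [l], equivalently a period [j] of the order
    relations. *)
Definition block_iso m (s : 'S_m) l j : bool :=
  [forall u : 'I_l, forall v : 'I_l,
    (pn s u < pn s v) == (pn s (j + u) < pn s (j + v))].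

Lemma block_isoP m (s : 'S_m) l j :
  reflect (forall u v, u < l -> v < l ->
             (pn s u < pn s v) = (pn s (j + u) < pn s (j + v)))
          (block_iso s l j).
Proof.
apply: (iffP idP) => [h u v um vm|h].
  by have /forallP/(_ (Ordinal um))/forallP/(_ (Ordinal vm))/eqP := h.
by apply/forallP => u; apply/forallP => v; apply/eqP/h.
Qed.

(** Sum over the common pattern [t]: given [t] on the block at [j], the disjoint block at 0 has
    pattern [t] with probability [1/l!]. *)
Lemma card_block_iso m l j : l <= j -> j + l <= m ->
  #|[pred s : 'S_m | block_iso s l j]| * l`! = m`!.
Proof.
move=> lj jlm; rewrite (card_sum_occurs l 0) big_distrl /=.
rewrite -[RHS]card_Sn (card_sum_occurs l j predT); apply: eq_bigr => t _ /=.
rewrite -(@card_occurs m l 0 [pred s : 'S_m | occurs s t j] t); try lia.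
  congr muln; apply: eq_card => s; rewrite !inE /=.
  have [ho|_] := boolP (occurs s t 0); last by rewrite !andbF.
  rewrite !andbT; move/occursP: ho => ho.
  by apply/block_isoP/occursP => h u v ul vl; have := h u v ul vl;
    rewrite -(ho u v).
by move=> q p qx /=; rewrite occurs_fix // => x ?; apply: qx; lia.
Qed.

(** Indexed by the shift [d]: the bound [d < m - k] says that the overlap length [m - d] exceeds
    [k]. *)
Definition overlap_free m (s : 'S_m) k :=
  [forall d : 'I_m, (0 < d < m - k) ==> ~~ block_iso s (m - d) d].

Lemma block_iso_double m (s : 'S_m) d : block_iso s (m - d) d ->
  block_iso s (m - d.*2) d.*2.
Proof.
move=> /block_isoP h; apply/block_isoP => u v um vm.
rewrite -addnn -!addnA.
by rewrite -(h (d + u) (d + v)) -?(h u v) //; lia.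
Qed.

(* Repeated doubling brings a period below m/2 into (m/4, m/2], where it
   compares two disjoint blocks that are long enough. *)
Lemma block_iso_long m (s : 'S_m) d :
  0 < d -> 2 * d <= m -> block_iso s (m - d) d ->
  exists2 e, m < 4 * e & (2 * e <= m) && block_iso s e e.
Proof.
have [r] := ubnP (m - d); elim: r d => // r IHr d mdr d0 dm h.
have [md|md] := ltnP m (4 * d).
  exists d; rewrite ?dm //=; apply/block_isoP => u v ud vd.
  by move/block_isoP: h => ->//; lia.
by apply: (IHr d.*2); [lia..|exact: block_iso_double].
Qed.

Lemma card_not_overlap_free m k :
  #|[pred s : 'S_m | ~~ overlap_free s k]| <=
  \sum_(l < m | k < l)
    #|[pred s : 'S_m | (2 * l <= m) && block_iso s l (m - l)]| +
  \sum_(d < m | m < 4 * d)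
    #|[pred s : 'S_m | (2 * d <= m) && block_iso s d d]|.
Proof.
pose R (i : 'I_m + 'I_m) : pred 'S_m := match i with
  | inl l =>
    [pred s : 'S_m | (k < l) && ((2 * l <= m) && block_iso s l (m - l))]
  | inr d =>
    [pred s : 'S_m | (m < 4 * d) && ((2 * d <= m) && block_iso s d d)]
  end.
have U s : ~~ overlap_free s k -> pred0 s \/ exists i, R i s.
  rewrite negb_forall => /existsP[[d /= dm]]; rewrite negb_imply negbK.
  move=> /andP[/andP[d0 dk] h]; right.
  (* A shift [d] of at most [m/2] is a short period and goes to the second sum; otherwise the
     overlap length [m - d] is below [m/2] and indexes the first. *)
  have [d2|d2] := leqP (2 * d) m.
    have [e e1 /andP[e2 e3]] := block_iso_long d0 d2 h.
    have em : e < m by lia.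
    by exists (inr (Ordinal em)); rewrite /= e1 e2.
  have lm : m - d < m by lia.
  exists (inl (Ordinal lm)) => /=; rewrite subKn; last by lia.
  by rewrite h andbT; lia.
apply: leq_trans (card_union_bound U) _; rewrite card0 add0n big_sumType /=.
rewrite !(big_mkcond (fun _ => _ < _)) /=.
by apply: leq_add; apply: leq_sum => i _; case: ifP => // h;
  rewrite leqn0; apply/eqP/eq_card0 => s; rewrite unfold_in /= ?h.
Qed.

Lemma occurs_block_iso n m (p : 'S_n) (s : 'S_m) i d :
  occurs p s i -> occurs p s (i + d) -> block_iso s (m - d) d.
Proof.
move=> /occursP h1 /occursP h2; apply/block_isoP => u v um vm.
by rewrite -h2 -?addnA ?h1 //; lia.
Qed.

(** * Recursion for the number of permutations avoiding [s] in a prefix *)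

Section Recursion.
Variables (n m k : nat) (s : 'S_m).
Hypothesis m_gt0 : 0 < m.

(** This is [n! p(N)] in the notation of the overview. *)
Definition navoid N := #|[pred p : 'S_n | avoid p s N]|.

Lemma avoid_leq (p : 'S_n) N M : N <= M -> avoid p s M -> avoid p s N.
Proof. by move=> NM /avoidP h; apply/avoidP => i iN; apply: h; lia. Qed.

Lemma navoid_leq N M : N <= M -> navoid M <= navoid N.
Proof.
by move=> NM; apply/subset_leq_card/fintype.subsetP => p; apply: avoid_leq.
Qed.

Lemma navoid_small N : N < m -> navoid N = n`!.
Proof.
move=> Nm; rewrite -card_Sn; apply: eq_card => p; rewrite !inE.
by apply/avoidP => i; lia.
Qed.

(** The prefix of length [N], the window of length [m] and the window of length [d] are consecutive
    and disjoint, so [card_occurs] applies to each window in turn. *)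
Lemma navoid_occurs N (d : nat) (t : 'S_d) : N + m + d <= n ->
  (#|[pred p : 'S_n | avoid p s N && occurs p s N]| * m`! = navoid N) /\
  (#|[pred p : 'S_n | [&& avoid p s N, occurs p s N & occurs p t (N + m)]]|
     * (m`! * d`!)
     = navoid N).
Proof.
move=> Nn.
have avoid_fix q (p : 'S_n) M : (forall x, x < M -> pn q x = x) ->
    avoid p s M -> avoid (q * p)%g s M.
  move=> qx /avoidP h; apply/avoidP => i iM; rewrite occurs_fix ?h // => x ?.
  by apply: qx; lia.
have e : #|[pred p : 'S_n | avoid p s N && occurs p s N]| * m`! = navoid N.
  apply: card_occurs; first by lia.
  by move=> q p qx; apply: avoid_fix => x xN; apply: qx; lia.
split=> //; rewrite -e mulnCA mulnC; congr muln.
rewrite -(@card_occurs n d (N + m)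
  [pred p | avoid p s N && occurs p s N] t) //.
  by congr muln; apply: eq_card => p; rewrite !inE andbA.
move=> q p qx /= /andP[avp op]; rewrite avoid_fix ?occurs_fix // => x xN;
  apply: qx; lia.
Qed.

(** The first occurrence ends with entry number [N + 1]: this is the loss in passing from [N] to
    [N + 1]. *)
Definition first_occ N :=
  #|[pred p : 'S_n | avoid p s N && occurs p s (N.+1 - m)]|.

Lemma navoid_step N : m <= N.+1 -> navoid N = navoid N.+1 + first_occ N.
Proof.
move=> mN.
rewrite /navoid -(cardID [pred p | occurs p s (N.+1 - m)]) addnC; congr addn.
apply: eq_card => p; rewrite !inE /=.
apply/andP/avoidP => [[no /avoidP h] i iN|h].
  have [->|ne] := eqVneq i (N.+1 - m); first by [].
  by apply: h; lia.
by split; [apply: h; lia | apply/avoidP => i iN; apply: h; lia].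
Qed.

(** Avoidance on [N] entries is weakened to the [N + 1 - m] entries that precede the occurrence,
    which are disjoint from it. *)
Lemma first_occ_ub N : m <= N.+1 -> N < n ->
  first_occ N * m`! <= navoid (N.+1 - m).
Proof.
move=> mN Nn; have [<- _] := @navoid_occurs (N.+1 - m) 0 1 ltac:(by lia).
rewrite leq_mul2r; apply/orP; right.
apply/subset_leq_card/fintype.subsetP => p; rewrite !inE => /andP[avp ->].
by rewrite andbT; apply: avoid_leq avp; lia.
Qed.

Lemma first_occ_lb N : m <= N.+1 -> N < n -> overlap_free s k ->
  (m - k)`! * navoid (N.+1 - m) <=
  m`! * (m - k)`! * first_occ N + m * navoid (N.+1 - 2 * m).
Proof.
move=> mN Nn /forallP free; set M := N.+1 - m.
(* Occurrences at [M] that are not first: another one starts [d < m] earlier and meets the window at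
   [M]. *)
pose R (d : 'I_m) := [pred p : 'S_n |
  [&& 0 < d <= M, avoid p s (M - d), occurs p s (M - d) & occurs p s M]].
have U p : avoid p s M && occurs p s M ->
    avoid p s N && occurs p s M \/ exists d, R d p.
  move=> /andP[avp op]; rewrite op andbT.
  have [|/allPn[i]] := boolP (avoid p s N); first by left.
  rewrite mem_iota negbK => iN oi; right.
  have iM : ~~ (i + m <= M) 
    by apply: contraTN oi => iM; move/avoidP: avp; apply.
  have dm : M - i < m by lia.
  exists (Ordinal dm) => /=; rewrite subKn; last by lia.
  by rewrite op oi (avoid_leq _ avp) ?andbT; lia.
have [<- _] := @navoid_occurs M 0 1 ltac:(by lia).
have -> : m * navoid (N.+1 - 2 * m) = \sum_(d < m) navoid (N.+1 - 2 * m).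
  by rewrite sum_nat_const card_ord.
apply: (@leq_trans (m`! * (m - k)`! * (first_occ N + \sum_d #|R d|))).
  rewrite mulnA [X in X <= _]mulnC mulnA leq_mul2l; apply/orP; right.
  exact: card_union_bound U.
rewrite mulnDr leq_add2l big_distrr /=; apply: leq_sum => d _.
have dm := ltn_ord d.
have [dM|dM] := boolP (0 < d <= M); last first.
  rewrite (_ : #|R d| = 0) ?muln0 //.
  by apply: eq_card0 => p; rewrite !inE (negbTE dM).
have [dk|dk] := ltnP d (m - k).
  rewrite (_ : #|R d| = 0) ?muln0 //.
  apply: eq_card0 => p; rewrite !inE; apply/negP => /and4P[_ _ o1 o2].
  have /implyP/(_ _)/negP := free d; apply; first by lia.
  by apply: (occurs_block_iso o1); rewrite subnK //; lia.
(* The last [d] entries of the later occurrence lie beyond the earlier one and must have the pattern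
   [t] of the last [d] entries of [s]; they form the third disjoint window. *)
have [t /occursP ot] := @occurs_exists m d s (m - d).
have [_ e] := @navoid_occurs (M - d) d t ltac:(by lia).
apply: leq_trans (_ : navoid (M - d) <= _); last first.
  by apply: navoid_leq; lia.
rewrite -e mulnC; apply: leq_mul; last first.
  by rewrite leq_mul2l leq_fact ?orbT.
apply/subset_leq_card/fintype.subsetP => p; rewrite !inE.
move=> /and4P[_ -> -> /occursP op] /=.
apply/occursP => u v ud vd; rewrite -ot // -op; try lia.
by congr (pn p _ < pn p _); lia.
Qed.

(** By [first_occ_ub] and monotonicity, each of the [t] steps loses at most
    [navoid (c - m) / m!]. *)
Lemma navoid_telescope c t : c + t <= n ->
  navoid c * m`! <= navoid (c + t) * m`! + t * navoid (c - m).
Proof.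
elim: t => [|t IHt] ctn; first by rewrite addn0 leq_addr.
apply: leq_trans (IHt _) _; first by lia.
rewrite mulSn addnA leq_add2r addnS.
have [mct|mct] := leqP m (c + t).+1; last first.
  by rewrite !navoid_small ?leq_addr //; lia.
rewrite (navoid_step mct) mulnDl leq_add2l.
apply: leq_trans (first_occ_ub mct _) _; first by lia.
by apply: navoid_leq; lia.
Qed.

(** Strong induction: with [c = N - 2 * m], the induction hypothesis at [c] bounds the loss over the
    at most [2 * m] steps from [c] to [N] by [4 * m * navoid c / m!], which is at most half of
    [navoid c] as [8 * m <= m!]. *)
Lemma navoid_ratio N : 8 * m <= m`! -> N <= n ->
  navoid (N - 2 * m) <= 2 * navoid N.
Proof.
move=> m8; elim/ltn_ind: N => N IHN Nn.
have [->|N0] := posnP N; first by rewrite sub0n; lia.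
set c := N - 2 * m.
have /IHN h : c < N by lia.
have {}h : navoid (c - 2 * m) <= 2 * navoid c by apply: h; lia.
have tel : navoid c * m`! <=
    navoid (c + (N - c)) * m`! + (N - c) * navoid (c - m).
  by apply: navoid_telescope; lia.
rewrite subnKC in tel; last by lia.
have h2 : navoid (c - m) <= 2 * navoid c.
  by apply: leq_trans h; apply: navoid_leq; lia.
have h3 : (N - c) * navoid (c - m) <= 2 * m * (2 * navoid c).
  by apply: leq_mul => //; lia.
have h4 : 8 * m * navoid c <= m`! * navoid c by rewrite leq_mul2r m8 orbT.
rewrite -(leq_pmul2r (fact_gt0 m)); lia.
Qed.

(** The final inequality of the overview, with denominators cleared and subtractions moved across to
    stay in [nat]. *)
Lemma navoid_decay N : 8 * m <= m`! -> m <= N.+1 -> N < n -> overlap_free s k ->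
  navoid N.+1 * (m`! * (m - k)`!) + (m - k)`! * navoid N <=
  navoid N * (m`! * (m - k)`!) + 2 * m * navoid N.
Proof.
move=> m8 mN Nn free; have := first_occ_lb mN Nn free.
have h1 : navoid N <= navoid (N.+1 - m) by apply: navoid_leq; lia.
have h2 : navoid (N.+1 - 2 * m) <= 2 * navoid N.
  by apply: leq_trans (navoid_ratio m8 (ltnW Nn)); apply: navoid_leq; lia.
have h3 : (m - k)`! * navoid N <= (m - k)`! * navoid (N.+1 - m).
  by rewrite leq_mul2l h1 orbT.
have h4 : m * navoid (N.+1 - 2 * m) <= m * (2 * navoid N).
  by rewrite leq_mul2l h2 orbT.
rewrite [navoid N as X in X * (m`! * _)](navoid_step mN); lia.
Qed.

End Recursion.

Local Open Scope ring_scope.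

(** * Factorial estimates *)

Lemma leq_expn4_fact n : (9 <= n)%N -> (4 ^ n <= n`!)%N.
Proof.
move=> /subnK <-; elim: (n - 9)%N => [|i IHi].
  by rewrite !factS fact0 !expnS expn0; lia.
by rewrite addSn factS expnS leq_mul //; lia.
Qed.

Lemma leq_mul8_fact n : (9 <= n)%N -> (8 * n <= n`!)%N.
Proof.
case: n => [//|[//|n]] n9; rewrite !factS.
by have := fact_gt0 n; nia.
Qed.

Lemma leq_mul2_expn4 n : (2 * n <= 4 ^ n)%N.
Proof. by elim: n => // n; rewrite expnS; case: n => // n; lia. Qed.

Lemma sum_inv_fact (R : realFieldType) (k m : nat) :
  \sum_(l < m | (k < l)%N) (l`!%:R^-1 : R) <= 2 / (k.+1)`!%:R.
Proof.
have f0 n : 0 < (n`!%:R : R) by rewrite ltr0n fact_gt0.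
have [mk|km] := leqP m k.+1.
  rewrite big1 ?divr_ge0 ?ltW // => l kl; have := ltn_ord l; lia.
rewrite -(big_mkord (fun l => (k < l)%N) (fun l => (l`!%:R^-1 : R))).
rewrite (big_cat_nat (n := k.+1)) //=; last exact: ltnW.
rewrite big_nat_cond big1 ?add0r; last by move=> i; lia.
rewrite big_nat_cond (eq_bigl (fun i => (k < i < m)%N && true)); last first.
  by move=> i; lia.
rewrite -big_nat_cond -(subnK (ltnW km)).
(* The added term [2 / (t + k + 1)!] dominates the remaining tail and makes the induction close:
   with [j = t + k + 1], a step needs only [2 / (j + 1) <= 1]. *)
suff : forall t,
    \sum_(k.+1 <= i < t + k.+1) (i`!%:R^-1 : R) + 2 / (t + k.+1)`!%:R
    <= 2 / (k.+1)`!%:R.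
  move=> /(_ (m - k.+1)%N); apply: le_trans.
  by rewrite lerDl divr_ge0 // ltW.
elim=> [|t IHt]; first by rewrite add0n big_geq ?add0r.
apply: le_trans IHt; rewrite addSn big_nat_recr ?leq_addl //= -addrA lerD2l.
set j := (t + k.+1)%N; rewrite factS natrM invfM mulrA.
have j1 : (1 : R) <= j%:R by rewrite ler1n /j; lia.
have : 2 / j.+1%:R <= (1 : R).
  by rewrite ler_pdivrMr ?ltr0n // mul1r ler_nat; rewrite ler1n in j1; lia.
have : 0 < (j`!%:R^-1 : R) by rewrite invr_gt0.
move: (2 / j.+1%:R) (j`!%:R^-1) => a b b0 a1; nra.
Qed.

(** * From counting bounds to the growth rate *)

(** The factor [K] disappears in the limit because [K^(1/n)] tends to 1. *)
Lemma rho_le (R : realType) m (s : 'S_m) (K x : R) : 0 < K -> 0 < x ->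
  (forall n, (alpha n s)%:R <= n`!%:R * (K * x ^+ n)) -> rho R s <= x.
Proof.
move=> K0 x0 h; rewrite /rho; set u := fun n => _.
(* Convergence need not be proved: a divergent limn is the junk value 0. *)
have [uc|/dvgP ->] := pselect (cvgn u); last exact: ltW.
have vc : ((fun n => K `^ (n%:R^-1) * x) @ \oo --> x)%classic.
  rewrite -[X in (_ --> X)%classic]mul1r; apply: cvgMl.
  have inv0 : ((fun n => n%:R^-1 : R) @ \oo --> (0 : R))%classic.
    by rewrite -cvg_shiftS; exact: cvg_harmonic.
  have : ((fun n => expR (n%:R^-1 * ln K)) @ \oo --> expR (0 * ln K))%classic.
    apply: (@continuous_cvg _ _ _ _ _ _ (@expR R)).
      exact: continuous_expR.
    exact: cvgMl.
  rewrite mul0r expR0.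
  have -> // : (fun n => expR (n%:R^-1 * ln K)) = (fun n => K `^ n%:R^-1).
  by apply/funext => n; rewrite /powR gt_eqF.
rewrite -(cvg_lim (@norm_hausdorff _ _) vc).
apply: ler_lim => //; first by apply/cvg_ex; exists x.
near=> n.
have n0 : (n%:R : R) != 0.
  by rewrite pnatr_eq0 -lt0n; near: n; exists 1%N.
have -> : K `^ n%:R^-1 * x = (K * x ^+ n) `^ n%:R^-1.
  rewrite powRM ?exprn_ge0 // ?ltW // -powR_mulrn ?ltW // -powRrM mulfV //.
  by rewrite powRr1 // ltW.
apply: ge0_ler_powR; rewrite ?invr_ge0 ?nnegrE ?divr_ge0 //.
  by rewrite mulr_ge0 ?exprn_ge0 ?ltW.
by rewrite ler_pdivrMr ?ltr0n ?fact_gt0 // mulrC.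
Unshelve. all: by end_near.
Qed.

Lemma alpha_le_fact n m (s : 'S_m) : (alpha n s <= n`!)%N.
Proof. by rewrite -[n`!]card_Sn max_card. Qed.

Lemma rho_le_ge1 (R : realType) m (s : 'S_m) (x : R) : 1 <= x -> rho R s <= x.
Proof.
move=> x1; apply: (@rho_le _ _ _ 1) => //; first exact: lt_le_trans x1.
move=> n; rewrite mul1r -[leLHS]mulr1 ler_pM ?ler_nat ?alpha_le_fact //.
exact: exprn_ege1.
Qed.

Lemma rho_le_overlap_free (R : realType) m k (s : 'S_m) (x : R) :
  (0 < m)%N -> (8 * m <= m`!)%N -> overlap_free s k ->
  1 - m`!%:R^-1 + (2 * m)%:R / (m`!%:R * (m - k)`!%:R) <= x -> 0 < x ->
  rho R s <= x.
Proof.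
move=> m0 m8 free hx x0; have [x1|x1] := leP 1 x; first exact: rho_le_ge1.
(* The factor [x ^- m] covers the prefixes shorter than [m], where nothing decays yet; here
   [x < 1]. *)
apply: (@rho_le _ _ _ (x ^- m)); rewrite ?invr_gt0 ?exprn_gt0 // => n.
rewrite alphaE.
suff : forall N, (N <= n)%N -> (navoid n s N)%:R <= n`!%:R * (x ^- m * x ^+ N).
  exact.
elim=> [|N IHN] Nn.
  rewrite navoid_small // expr0 mulr1 ler_peMr // invf_ge1 ?exprn_gt0 //.
  by rewrite exprn_ile1 // ltW.
have [mN|mN] := leqP m N.+1; last first.
  rewrite navoid_small // ler_peMr // mulrC ler_pdivlMr ?exprn_gt0 // mul1r.
  by apply: ler_wiXn2l; [exact: ltW|exact: ltW|exact: ltnW].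
apply: le_trans (_ : x * (navoid n s N)%:R <= _); last first.
  rewrite exprS [leRHS](_ : _ = x * (n`!%:R * (x ^- m * x ^+ N))); last by ring.
  by rewrite ler_pM2l // IHN // ltnW.
have := navoid_decay m0 m8 mN Nn free; rewrite -(ler_nat R) !natrD !natrM.
set a : R := (navoid n s N.+1)%:R; set b : R := (navoid n s N)%:R.
set f : R := m`!%:R; set g : R := (m - k)`!%:R => h.
have f0 : 0 < f by rewrite ltr0n fact_gt0.
have g0 : 0 < g by rewrite ltr0n fact_gt0.
apply: le_trans (_ : (1 - f^-1 + (2 * m)%:R / (f * g)) * b <= _); last first.
  by rewrite ler_wpM2r.
rewrite -(ler_pM2r (mulr_gt0 f0 g0)).
have -> : (1 - f^-1 + (2 * m)%:R / (f * g)) * b * (f * g) =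
   b * (f * g) + 2 * m%:R * b - g * b.
  by rewrite natrM; field; rewrite !gt_eqF.
lra.
Qed.

(** * Probability of a long self-overlap, and conclusion *)

Lemma card_block_iso_le m l j :
  ((2 * l <= m)%N -> (l <= j)%N && (j + l <= m)%N) ->
  (#|[pred s : 'S_m | (2 * l <= m)%N && block_iso s l j]| * l`! <= m`!)%N.
Proof.
have [_ /(_ isT)/andP[lj jlm]|_ _] := leqP (2 * l) m.
  by rewrite (card_block_iso lj jlm).
by rewrite (eq_card0 (A := [pred s : 'S_m | _])) ?mul0n.
Qed.

Lemma prob_not_overlap_free (R : realType) m k : (36 <= m)%N ->
  (#|[pred s : 'S_m | ~~ overlap_free s k]|%:R : R) <=
  m`!%:R * (2 / (k.+1)`!%:R + m%:R * 2 `^ (- (m%:R / 2))).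
Proof.
move=> m36; have f0 n : 0 < (n`!%:R : R) by rewrite ltr0n fact_gt0.
have le l j : ((2 * l <= m)%N -> (l <= j)%N && (j + l <= m)%N) ->
  (#|[pred s : 'S_m | (2 * l <= m)%N && block_iso s l j]|%:R : R)
    <= m`!%:R * l`!%:R^-1.
  by move=> /card_block_iso_le; rewrite ler_pdivlMr // -natrM ler_nat.
have := card_not_overlap_free m k; rewrite -(ler_nat R) natrD !natr_sum.
move/le_trans; apply; rewrite mulrDr; apply: lerD.
  apply: le_trans (ler_wpM2l (ltW (f0 m)) (sum_inv_fact R k m)).
  rewrite big_distrr /=; apply: ler_sum => l _; apply: le.
  by have := ltn_ord l; lia.
apply: le_trans (_ : \sum_(d < m) (m`!%:R * 2 `^ (- (m%:R / 2))) <= _).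
  rewrite big_mkcond; apply: ler_sum => d _; case: ifP => [md|_]; last first.
    by rewrite mulr_ge0 // powR_ge0.
  apply: le_trans (le d d _) _; first by lia.
  rewrite ler_pM2l // powRN lef_pV2 ?posrE ?powR_gt0 //.
  (* From [36 <= m < 4 * d] follow [9 <= d], hence [4^d <= d!], and [2^(m/2) <= 2^(2d) = 4^d]. *)
  apply: le_trans (_ : 4 ^+ d <= _); last first.
    by rewrite -natrX ler_nat leq_expn4_fact //; lia.
  rewrite (_ : 4 ^+ d = 2 `^ (2 * d)%:R); last first.
    by rewrite powR_mulrn // exprM; congr (_ ^+ _); ring.
  apply: ler_powR; first by lra.
  rewrite ler_pdivrMr // -natrM ler_nat; lia.
by rewrite sumr_const card_ord [leRHS]mulrCA [leRHS]mulr_natl.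
Qed.

Theorem theorem3 (R : realType) :
  exists2 C : R, 0 < C &
    forall m k : nat, (2 <= k)%N -> (2 * k <= m)%N ->
      1 - 2 / (k.+1)`!%:R - m%:R * 2 `^ (- (m%:R / 2)) <=
      finite_unif_prob R (fun s : 'S_m =>
        rho R s <= 1 - 1 / m`!%:R + C * (4 ^+ m / ((m - k)`!%:R * m`!%:R))).
Proof.
have f0 n : 0 < (n`!%:R : R) by rewrite ltr0n fact_gt0.
have [C C1 CP] : exists2 C : R, 1 <= C & forall j, (j <= 36)%N -> j`!%:R <= C.
  (* For [m < 36] this constant dominates [(m - k)!], so the error term alone outweighs [1/m!]. *)
  exists 36`!%:R; first by rewrite ler1n fact_gt0.
  by move=> j j36; rewrite ler_nat leq_fact.
have C0 : 0 < C by exact: lt_le_trans C1.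
exists C => // m k k2 km; rewrite /finite_unif_prob card_Sn.
rewrite ler_pdivlMr // mul1r; set x := 1 - _ + C * _.
have fm1 : (m`!%:R^-1 : R) < 1.
  rewrite invf_lt1 // ltr1n (@leq_trans (4)`!) // leq_fact //; lia.
have [m36|m36] := ltnP m 36.
  have x1 : 1 <= x.
    rewrite /x -addrA lerDl addrC subr_ge0 invfM !mulrA.
    rewrite -[leLHS]mul1r ler_pM2r ?invr_gt0 //.
    rewrite ler_pdivlMr // mul1r.
    apply: le_trans (_ : C <= _); first by apply: CP; lia.
    by rewrite ler_peMr ?(ltW C0) // exprn_ege1 //; lra.
  rewrite (eq_card (B := predT)); last first.
    by move=> s; rewrite [LHS]unfold_in rho_le_ge1.
  rewrite card_Sn; apply: ler_piMl; first exact: ltW.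
  have : 0 <= 2 / (k.+1)`!%:R :> R by rewrite divr_ge0 // ltW.
  have : 0 <= m%:R * 2 `^ (- (m%:R / 2)) :> R by rewrite mulr_ge0 ?powR_ge0.
  move: (2 / _) (m%:R * _) => a b; lra.
have x0 : 0 < x.
  rewrite /x ltr_wpDr ?subr_gt0 //.
  by rewrite mulr_ge0 ?ltW // divr_gt0 ?exprn_gt0 ?mulr_gt0.
apply: le_trans (_ : #|[pred s : 'S_m | overlap_free s k]|%:R <= _); last first.
  rewrite ler_nat; apply: subset_leq_card; apply/fintype.subsetP => s.
  rewrite inE => free; rewrite unfold_in.
  apply: (rho_le_overlap_free _ _ free) => //; first by lia.
    by apply: leq_mul8_fact; lia.
  (* What remains is [2 * m <= C * 4^m], from [1 <= C] and [2 * m <= 4^m]. *)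
  rewrite /x lerD2l mulrA (mulrC (_ - _)`!%:R) ler_pM2r ?invr_gt0 ?mulr_gt0 //.
  rewrite -[leLHS]mul1r ler_pM // -natrX ler_nat.
  exact: leq_mul2_expn4.
have := prob_not_overlap_free R k m36.
have : (#|[pred s : 'S_m | overlap_free s k]| +
    #|[pred s : 'S_m | ~~ overlap_free s k]| = m`!)%N.
  by rewrite -[m`!]card_Sn -(cardC [pred s : 'S_m | overlap_free s k]).
move/(congr1 (fun n => n%:R : R)); rewrite natrD.
move: (f0 m) => ? <-; lra.
Qed.
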